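(* Let $E$ be a Banach space, let $X$ be a standard sequence class and let $\{Y_\lambda\}_{\lambda\in\Lambda}$ ($\Lambda\ne\emptyset$) be an $E$-nested family of standard sequence classes such that the triple $(X,\mathrm{Id}_E,\{Y_\lambda\}_{\lambda\in\Lambda})$ is detachable, where $\mathrm{Id}_E$ is the identity map of $E$. If the set $X(E)\setminus\bigcup_{\lambda\in\Lambda}Y_\lambda(E)$ is non-empty, then, for a cardinal number $\alpha\le\mathfrak c$, it is $(\alpha,\mathfrak c)$-spaceable (as a subset of $X(E)$) if and only if $\alpha<\aleph_0$.
   Context: Banach spaces are over $\mathbb K=\mathbb R$ or $\mathbb C$. The Continuum Hypothesis is assumed; $\aleph_0$ and $\mathfrak c$ are the cardinalities of $\mathbb N$ and $\mathbb R$. Standard sequence class: a rule $X$ assigning to each Banach space $E$ a (quasi-)Banach space $X(E)$ of $E$-valued sequences (with coordinatewise operations) such that: (i) there is a constant $C>0$ with $c_{00}(E)\subseteq X(E)\subseteq\ell_\infty(E)$ and $\|\cdot\|_{\ell_\infty(E)}\le C\|\cdot\|_{X(E)}$ on $X(E)$, where $c_{00}(E)$ is the space of eventually null and $\ell_\infty(E)$ the space of bounded $E$-valued sequences; (ii) if $x=(x_j)_j\in X(E)$ and $(x_{n_k})_k$ is a subsequence, then $(x_{n_k})_k\in X(E)$ and $\|(x_{n_k})_k\|_{X(E)}\le\|x\|_{X(E)}$; (iii) if $x=(x_j)_j\in X(E)$ and $n_1<n_2<\cdots$ are natural numbers, then the sequence $y$ having $x_i$ in coordinate $n_i$ for every $i$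 and $0$ in all other coordinates belongs to $X(E)$ and $\|y\|_{X(E)}\le\|x\|_{X(E)}$. $E$-nested: for all $\lambda_1,\lambda_2\in\Lambda$, $Y_{\lambda_1}(E)\subseteq Y_{\lambda_2}(E)$ or $Y_{\lambda_2}(E)\subseteq Y_{\lambda_1}(E)$. Detachable: the triple $(X,\mathrm{Id}_E,\{Y_\lambda\}_{\lambda\in\Lambda})$ is detachable if for every $\lambda\in\Lambda$ and every $(x_j)_j\in X(E)\setminus Y_\lambda(E)$ there is an infinite set $\mathbb N_1\subset\mathbb N$ with infinite complement such that $(x_n)_{n\in\mathbb N_1}\in Y_\lambda(E)$ (indexed in increasing order). $(\alpha,\beta)$-spaceable: for cardinals $\alpha\le\beta$ and a topological vector space $V$, a set $A\subset V$ is $(\alpha,\beta)$-spaceable if $A\cup\{0\}$ contains an $\alpha$-dimensional linear subspace of $V$ and, for every $\alpha$-dimensional subspace $U_\alpha\subset A\cup\{0\}$, there is a closed $\beta$-dimensional subspace $U_\beta$ of $V$ with $U_\alpha\subset U_\beta\subset A\cup\{0\}$. Dimension means algebraic (Hamel) dimension. *)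

(* Defs.v *)
From HB Require Import structures.
From mathcomp Require Import all_boot all_order all_algebra.
From mathcomp Require Import all_classical all_reals all_analysis.
From mathcomp Require Import complex.

Set Implicit Arguments.
Unset Strict Implicit.
Unset Printing Implicit Defensive.

Import Order.TTheory GRing.Theory Num.Theory.
Import numFieldNormedType.Exports.

Local Open Scope classical_set_scope.
Local Open Scope card_scope.
Local Open Scope ring_scope.

Definition scalar_field (R : realType) (cplx : bool) : numFieldType :=
  if cplx then (R[i] : numFieldType) else (R : numFieldType).

(** * Cardinals, Hamel dimension and spaceability *)

(* A cardinal number is given by a type of that cardinality. *)
Definition card_lt (I J : Type) : Prop :=
  [set: I] #<= [set: J] /\ ~ ([set: J] #<= [set: I]).

Definition continuum_hypothesis (R : realType) : Prop :=
  forall A : set R, A #<= [set: nat] \/ A #= [set: R].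

Section Dimension.
Context {K : numFieldType} {V : lmodType K}.
Implicit Types U B : set V.

Definition lin_subspace U : Prop := GRing.submod_closed (mem U).

Definition lin_indep B : Prop :=
  forall (s : seq V) (c : V -> K), uniq s -> [set` s] `<=` B ->
    \sum_(v <- s) c v *: v = 0 -> forall v, v \in s -> c v = 0.

Definition lin_span B : set V :=
  [set x | exists (s : seq V) (c : V -> K),
     [set` s] `<=` B /\ x = \sum_(v <- s) c v *: v].

Definition has_dim U (I : Type) : Prop :=
  exists B, [/\ lin_indep B, lin_span B = U & B #= [set: I]].

End Dimension.

Definition spaceable {K : numFieldType} {V : topologicalLmodType K}
    (I J : Type) (A : set V) : Prop :=
  (exists U : set V,
     [/\ lin_subspace U, has_dim U I & U `<=` A `|` [set 0]]) /\
  (forall U : set V,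
     lin_subspace U -> has_dim U I -> U `<=` A `|` [set 0] ->
     exists W : set V, [/\ lin_subspace W, closed W, has_dim W J,
       U `<=` W & W `<=` A `|` [set 0]]).

(** * Quasi-normed spaces of sequences *)

(* [seq_qnorm] is only meaningful on [seq_dom].  As for norms in the library,
   its values are nonnegative elements of [K]; this makes them real when [K] is
   the field of complex numbers. *)
Record qnormed_seqs (K : numFieldType) (E : normedModType K) := QNormedSeqs {
  seq_dom : set (nat -> E);
  seq_qnorm : (nat -> E) -> K;
  seq_dom_submod : lin_subspace seq_dom;
  seq_qnorm_ge0 : forall x, seq_dom x -> 0 <= seq_qnorm x;
  seq_qnorm0_eq0 : forall x, seq_dom x -> seq_qnorm x = 0 -> x = 0;
  seq_qnormZ : forall (a : K) x, seq_dom x ->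
    seq_qnorm (a *: x) = `|a| * seq_qnorm x;
  seq_qnormD : exists2 C : K, 1 <= C & forall x y, seq_dom x -> seq_dom y ->
    seq_qnorm (x + y) <= C * (seq_qnorm x + seq_qnorm y)
}.

Definition seqs_pred (K : numFieldType) (E : normedModType K)
  (X : qnormed_seqs E) : {pred nat -> E} := mem (seq_dom X).

Record seqs_type (K : numFieldType) (E : normedModType K)
    (X : qnormed_seqs E) := SeqsType {
  seqs_val :> nat -> E;
  seqs_valP : seqs_val \in seqs_pred X
}.

Section SeqsTopology.
Context (K : numFieldType) (E : normedModType K) (X : qnormed_seqs E).

HB.instance Definition _ := [isSub for @seqs_val K E X].
HB.instance Definition _ := [Choice of seqs_type X by <:].
HB.instance Definition _ :=
  GRing.isSubmodClosed.Build _ _ (seqs_pred X)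
    (GRing.submod_closed_semi (seq_dom_submod X)).
HB.instance Definition _ := [SubChoice_isSubLmodule of seqs_type X by <:].

Local Notation V := (seqs_type X).

Definition qnorm (x : V) : K := seq_qnorm X x.

Lemma seqs_dom (x : V) : seq_dom X x.
Proof. exact: set_mem (seqs_valP x). Qed.

Lemma qnorm_ge0 x : 0 <= qnorm x.
Proof. exact: seq_qnorm_ge0 (seqs_dom x). Qed.

Lemma qnormZ a x : qnorm (a *: x) = `|a| * qnorm x.
Proof. exact: (seq_qnormZ a (seqs_dom x)). Qed.

Lemma qnorm0 : qnorm 0 = 0.
Proof. by rewrite -(scale0r (0 : V)) qnormZ normr0 mul0r. Qed.

Lemma qnormB x y : qnorm (x - y) = qnorm (y - x).
Proof. by rewrite -opprB -scaleN1r qnormZ normrN1 mul1r. Qed.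

Lemma qnorm_small (e : K) : 0 < e -> exists2 d : K, 0 < d &
  forall x y, qnorm x < d -> qnorm y < d -> qnorm (x + y) < e.
Proof.
move=> e0; have [C C1 Cadd] := seq_qnormD X.
have C0 : 0 < C by exact: lt_le_trans C1.
exists (e / C / 2) => [|x y xd yd]; first by rewrite !divr_gt0.
apply: le_lt_trans (Cadd _ _ (seqs_dom x) (seqs_dom y)) _.
rewrite mulrC -ltr_pdivlMr// [ltRHS](splitr (e / C)).
exact: ltrD xd yd.
Qed.

Definition seqs_entourage : set_system (V * V) :=
  [set A | exists2 e : K, 0 < e & forall x y, qnorm (x - y) < e -> A (x, y)].

Lemma seqs_entourage_filter : Filter seqs_entourage.
Proof.
split.
- by exists 1.
- move=> A B [e e0 eA] [f f0 fB]; have [ef|ef] :=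
    orP (real_leVge (gtr0_real e0) (gtr0_real f0)).
  + by exists e => // x y xy; split; [exact: eA|exact: fB (lt_le_trans xy ef)].
  + by exists f => // x y xy; split; [exact: eA (lt_le_trans xy ef)|exact: fB].
- by move=> A B AB [e e0 eA]; exists e => // x y /eA /AB.
Qed.

Lemma seqs_entourage_diagonal A : seqs_entourage A -> diagonal `<=` A.
Proof.
move=> [e e0 eA] [x y] xy; have {xy}-> : x = y by [].
by apply: eA; rewrite subrr qnorm0.
Qed.

Lemma seqs_entourage_inv A :
  seqs_entourage A -> seqs_entourage A^-1%relation.
Proof. by move=> [e e0 eA]; exists e => // x y; rewrite qnormB => /eA. Qed.

Lemma seqs_entourage_split A : seqs_entourage A ->
  exists2 B, seqs_entourage B & (B \; B)%relation `<=` A.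
Proof.
move=> [e e0 eA]; have [d d0 dP] := qnorm_small e0.
exists [set xy | qnorm (xy.1 - xy.2) < d]; first by exists d.
move=> [x y] [z /= xz zy]; apply: eA.
by rewrite -[x](subrK z) -addrA; exact: dP.
Qed.

HB.instance Definition _ := isUniform.Build V seqs_entourage_filter
  seqs_entourage_diagonal seqs_entourage_inv seqs_entourage_split.

Lemma seqs_nbhsP (x : V) (A : set V) :
  nbhs x A <-> exists2 e : K, 0 < e & forall y, qnorm (x - y) < e -> A y.
Proof.
rewrite -filter_from_entourageE; split.
  move=> [B [e e0 eB] BA]; exists e => // y /eB xy; exact/BA/mem_set.
move=> [e e0 eA]; exists [set xy | qnorm (xy.1 - xy.2) < e]; first by exists e.
by move=> y /set_mem/= /eA.
Qed.

Lemma seqs_add_continuous : continuous (fun x : V * V => x.1 + x.2).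
Proof.
move=> [x y]/= A /seqs_nbhsP[e e0 eA]; have [d d0 dP] := qnorm_small e0.
exists ([set z | qnorm (x - z) < d], [set z | qnorm (y - z) < d]) => /=.
  by split; apply/seqs_nbhsP; exists d.
by move=> [u v]/= [xu yv]; apply: eA; rewrite opprD addrACA; exact: dP.
Qed.

Lemma seqs_scale_continuous : continuous (fun z : K^o * V => z.1 *: z.2).
Proof.
move=> [a x]/= A /seqs_nbhsP[e e0 eA]; have [d d0 dP] := qnorm_small e0.
have x0 : 0 < qnorm x + 1 by rewrite ltr_wpDl// qnorm_ge0.
have a0 : 0 < `|a| + 1 by rewrite ltr_wpDl.
exists ([set b : K^o | `|a - b| < 1 /\ `|a - b| < d / (qnorm x + 1)],
        [set z | qnorm (x - z) < d / (`|a| + 1)]) => /=.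
  split; last by apply/seqs_nbhsP; exists (d / (`|a| + 1)); rewrite ?divr_gt0.
  apply: filterI; first by apply/nbhs_ballP; exists 1 => /=.
  by apply/nbhs_ballP; exists (d / (qnorm x + 1)); rewrite /= ?divr_gt0.
move=> [b z]/= [[ab1 abd] xz]; apply: eA.
have -> : a *: x - b *: z = (a - b) *: x + b *: (x - z).
  by rewrite scalerBl scalerBr addrA subrK.
have b1 : `|b| <= `|a| + 1.
  rewrite -[b in leLHS](subKr a) (le_trans (ler_normB _ _))//.
  by rewrite lerD2l ltW.
apply: dP; rewrite qnormZ.
  apply: le_lt_trans (_ : `|a - b| * (qnorm x + 1) < d).
    by rewrite ler_wpM2l// lerDl.
  by rewrite -ltr_pdivlMr.
apply: le_lt_trans (_ : (`|a| + 1) * qnorm (x - z) < d).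
  by rewrite ler_wpM2r// qnorm_ge0.
by rewrite mulrC -ltr_pdivlMr.
Qed.

HB.instance Definition _ :=
  PreTopologicalNmodule_isTopologicalNmodule.Build V seqs_add_continuous.
HB.instance Definition _ :=
  TopologicalNmodule_isTopologicalLmodule.Build K V seqs_scale_continuous.

End SeqsTopology.

Record qbanach_seqs (K : numFieldType) (E : normedModType K) := QBanachSeqs {
  qbanach_qnormed :> qnormed_seqs E;
  qbanach_complete : forall u : nat -> seqs_type qbanach_qnormed,
    cauchy (u @ \oo) -> exists l : seqs_type qbanach_qnormed, u @ \oo --> l
}.

(** * Standard sequence classes *)

Definition c00 {K : numFieldType} (E : normedModType K) : set (nat -> E) :=
  [set x | \forall n \near \oo, x n = 0].

Definition linf {K : numFieldType} (E : normedModType K) : set (nat -> E) :=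
  [set x | bounded_fun x].

Arguments c00 {K} E _.
Arguments linf {K} E _.

Definition linf_norm (K : numFieldType) (E : normedModType K)
  (x : nat -> E) : K := supremum 0 (range (fun n => `|x n|)).

(* In [class_insert] the sequence [y] is [x] spread over the coordinates
   [n 0 < n 1 < ...] and completed by zeros. *)
Record seq_class (K : numFieldType) := SeqClass {
  class_space :> forall E : completeNormedModType K, qbanach_seqs E;
  class_c00 : forall E : completeNormedModType K,
    c00 E `<=` seq_dom (class_space E);
  class_linf : forall E : completeNormedModType K,
    seq_dom (class_space E) `<=` linf E;
  class_linf_norm : forall E : completeNormedModType K, exists2 C : K, 0 < C &
    forall x, seq_dom (class_space E) x ->
      linf_norm x <= C * seq_qnorm (class_space E) x;
  class_subseq : forall (E : completeNormedModType K) (x : nat -> E)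
    (n : nat -> nat), increasing_seq n ->
    seq_dom (class_space E) x ->
    seq_dom (class_space E) (x \o n) /\
    seq_qnorm (class_space E) (x \o n) <= seq_qnorm (class_space E) x;
  class_insert : forall (E : completeNormedModType K) (x y : nat -> E)
    (n : nat -> nat), increasing_seq n ->
    seq_dom (class_space E) x ->
    (forall i, y (n i) = x i) -> (forall j, ~ range n j -> y j = 0) ->
    seq_dom (class_space E) y /\
    seq_qnorm (class_space E) y <= seq_qnorm (class_space E) x
}.

Section Families.
Context {K : numFieldType} {L : Type}.
Variables (E : completeNormedModType K) (X : seq_class K)
  (Y : L -> seq_class K).

Definition nested : Prop := forall l1 l2 : L,
  seq_dom (Y l1 E) `<=` seq_dom (Y l2 E) \/
  seq_dom (Y l2 E) `<=` seq_dom (Y l1 E).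

(* [n] is the increasing enumeration of the infinite set [N1]. *)
Definition detachable : Prop := forall (l : L) (x : nat -> E),
  (seq_dom (X E) `\` seq_dom (Y l E)) x ->
  exists N1 : set nat, [/\ infinite_set N1, infinite_set (~` N1) &
    exists n : nat -> nat,
      [/\ increasing_seq n, range n = N1 & seq_dom (Y l E) (x \o n)]].

Definition class_diff : set (seqs_type (X E)) :=
  [set x | (seq_dom (X E) `\` \bigcup_l seq_dom (Y l E)) (x : nat -> E)].

End Families.

Arguments class_diff {K L} E X Y _.

(* Main.v *)
(* The infinite case fails by approximation.  If [U] is a subspace of
   [A u {0}] with an infinite basis, where [A] is the set in question, let [f]
   be a nonzero eventually null sequence, hence in every [Y l].  Replacing
   countably many basis vectors [g m] by [f + eps_m g m], with [eps_m g m]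
   tending to 0, gives a subspace of the same dimension in [A u {0}] whose
   closure contains [f].

   In the finite case, fix one [l] and pass to a subset [M] of the indices along
   which all generators of the given subspace [U] belong to [Y l].  Split [M]
   into infinitely many infinite blocks, fix [x] in [A], and add to [U] all
   sequences of [X] supported in [M] that are multiples of a copy of [x] on every
   block.  The sum is closed; it stays in [A u {0}], because an element of some
   [Y l'] has its [U]-part in the larger of [Y l] and [Y l'] by nestedness.  It
   embeds in [K^N x K^m], so its cardinality is at most the continuum, and it
   contains the independent family [\sum_k t ^ k y_k] for small [t], where [y_k]
   is the copy of [x] on block [k]; hence its dimension is the continuum. *)
Require Import Defs.
From mathcomp Require Import all_boot all_order all_algebra.
From mathcomp Require Import all_classical all_reals all_analysis.
From mathcomp Require Import complex.
From mathcomp Require Import ring lra.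

Set Implicit Arguments.
Unset Strict Implicit.
Unset Printing Implicit Defensive.

Import Order.TTheory GRing.Theory Num.Theory.
Import numFieldNormedType.Exports.

Local Open Scope classical_set_scope.
Local Open Scope card_scope.
Local Open Scope ring_scope.

(** * The continuum and the scalar field *)

Lemma inj_card_leTT (T U : Type) (f : T -> U) :
  injective f -> [set: T] #<= [set: U].
Proof.
move=> fI; rewrite -(card_le_eql (inj_card_eq (f := f) _)).
  exact: subset_card_le.
by move=> ? ? _ _; exact: fI.
Qed.

Lemma card_le_injP (T U : Type) (A : set T) (B : set U) : A #<= B ->
  exists f : A -> U, (forall x, B (f x)) /\ injective f.
Proof.
move=> /card_leP[f]; exists (fun x => val (f x)); split.
  by move=> x; exact: set_mem (valP (f x)).
by move=> x y /val_inj /inj; apply; rewrite inE.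
Qed.

Section TernarySums.
Variable R : realType.
Implicit Type b : nat -> bool.

Definition ternary_psum b n : R := \sum_(i < n) (b i)%:R / 3 ^+ i.

Lemma ternary_psumS b n :
  ternary_psum b n.+1 = ternary_psum b n + (b n)%:R / 3 ^+ n.
Proof. by rewrite /ternary_psum big_ord_recr. Qed.

(** [3 / 2 / 3 ^+ k] is the sum of all [3 ^- i] with [i >= k], so the upper bound can only drop as
    further digits are read. *)
Lemma ternary_psum_tail b k m :
  ternary_psum b (k + m) + (3 / 2) / 3 ^+ (k + m)
    <= ternary_psum b k + (3 / 2) / 3 ^+ k.
Proof.
elim: m => [|m IH]; first by rewrite addn0.
apply: le_trans IH; rewrite addnS ternary_psumS exprS invfM.
have : 0 < (3 ^+ (k + m) : R)^-1 by rewrite invr_gt0 exprn_gt0.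
by case: (b (k + m)%N) => /=; lra.
Qed.

Lemma ternary_psum_nondecreasing b : nondecreasing_seq (ternary_psum b).
Proof.
apply/nondecreasing_seqP => n; rewrite ternary_psumS lerDl.
by rewrite divr_ge0// exprn_ge0.
Qed.

Lemma ternary_psum_le b n k :
  ternary_psum b n <= ternary_psum b k + (3 / 2) / 3 ^+ k.
Proof.
have p3 j : 0 < (3 ^+ j : R)^-1 by rewrite invr_gt0 exprn_gt0.
have [kn|/ltnW nk] := leqP k n.
  have := ternary_psum_tail b k (n - k); rewrite subnKC//.
  by have := p3 n; lra.
apply: le_trans (ternary_psum_nondecreasing b nk) _.
by have := p3 k; lra.
Qed.

Definition ternary_sum b : R := sup (range (ternary_psum b)).

Lemma ternary_sum_has_ubound b : has_ubound (range (ternary_psum b)).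
Proof.
by exists (ternary_psum b 0 + (3 / 2) / 3 ^+ 0) => _ [n _ <-]; exact: ternary_psum_le.
Qed.

Lemma ternary_psum_le_sum b n : ternary_psum b n <= ternary_sum b.
Proof. by apply: ub_le_sup; [exact: ternary_sum_has_ubound|exists n]. Qed.

Lemma ternary_sum_le b k :
  ternary_sum b <= ternary_psum b k + (3 / 2) / 3 ^+ k.
Proof.
apply: ge_sup; first by exists (ternary_psum b 0), 0%N.
by move=> _ [n _ <-]; exact: ternary_psum_le.
Qed.

Lemma ternary_sum_itv b : 0 <= ternary_sum b <= 2.
Proof.
have := ternary_psum_le_sum b 0; have := ternary_sum_le b 0.
by rewrite /ternary_psum big_ord0 expr0 invr1; lra.
Qed.

(** At the first index [k] where the digits differ, the digit 1 is worth [3 ^- k], while all later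
    digits together are worth at most half of that. In base 2 there would be ties. *)
Lemma ternary_sum_inj : injective ternary_sum.
Proof.
suff lt b c k : (forall i, (i < k)%N -> b i = c i) -> b k -> ~~ c k ->
    ternary_sum c < ternary_sum b.
  move=> b c bc; apply/funext => n; elim/ltn_ind: n => n IH.
  apply/eqP/negPn/negP; case bn: (b n); case cn: (c n) => // _.
    by have := lt b c n IH; rewrite bn cn bc ltxx => /(_ isT isT).
  have := lt c b n (fun i ni => esym (IH i ni)).
  by rewrite bn cn bc ltxx => /(_ isT isT).
move=> bc bk ck.
apply: le_lt_trans (ternary_sum_le c k.+1) _.
apply: lt_le_trans (ternary_psum_le_sum b k.+1).
have -> : ternary_psum c k.+1 = ternary_psum b k.
  rewrite ternary_psumS (negbTE ck) mul0r addr0.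
  by apply: eq_bigr => i _; rewrite bc.
rewrite ternary_psumS bk exprS invfM.
have : 0 < (3 ^+ k : R)^-1 by rewrite invr_gt0 exprn_gt0.
by move=> /=; lra.
Qed.

End TernarySums.

(** The lower Dedekind cut of [x], read along the [pickle] coding of the rationals; indices that
    code no rational give [false]. *)
Definition rat_cut (R : realType) (x : R) (n : nat) : bool :=
  if unpickle n is Some q then ratr q < x else false.

Lemma rat_cut_inj (R : realType) : injective (@rat_cut R).
Proof.
suff lt (x y : R) : rat_cut x = rat_cut y -> y <= x.
  by move=> x y xy; apply/eqP; rewrite eq_le !lt.
move=> xy; rewrite leNgt; apply/negP => /rat_in_itvoo[q].
rewrite in_itv/= => /andP[xq qy].
have := congr1 (fun f => f (pickle q)) xy.
by rewrite /rat_cut pickleK qy ltNge (ltW xq).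
Qed.

(** Facts shared by the real and the complex field, gathered so that both cases are treated at once.
    Suprema serve to unfold [linf_norm], which is a supremum in [K]; the two bit maps serve to bound
    dimensions by the continuum from below and from above. *)
Record scalar_props (K : numFieldType) : Prop := ScalarProps {
  scalar_archi : forall e : K, 0 < e -> exists n, n.+1%:R^-1 < e;
  scalar_complete : forall c : nat -> K,
    (forall e, 0 < e -> exists N, forall m n, (N <= m)%N -> (N <= n)%N ->
       `|c m - c n| < e) ->
    exists l, forall e, 0 < e -> exists N, forall n, (N <= n)%N ->
       `|l - c n| < e;
  scalar_supremums : forall A : set K, A !=set0 -> (forall a, A a -> 0 <= a) ->
    has_ubound A -> supremums A !=set0;
  scalar_of_bits : exists2 t : (nat -> bool) -> K, injective t &
    forall b, `|t b| <= 2;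
  bits_of_scalar : exists f : K -> nat -> bool, injective f
}.

Lemma real_scalar_props (R : realType) : scalar_props R.
Proof.
split.
- by move=> e e0; have [n] := ltr_add_invr e0; rewrite add0r; exists n.
- move=> c cC.
  have /cauchy_cvg cvg_c : cauchy (c @ \oo).
    apply: cauchy_exP => e e0; have [N NP] := cC _ e0; exists (c N).
    by exists N => // n /= Nn; exact: NP.
  exists (lim (c @ \oo)) => e e0.
  have [N _ NP] := (@cvgrPdist_lt _ _ _ _ _ _ _).1 cvg_c _ e0.
  by exists N => n /NP.
- move=> A A0 _ Aub; exists (sup A); split; first exact: ub_le_sup.
  by move=> y Ay; exact: ge_sup.
- exists (@ternary_sum R); first exact: ternary_sum_inj.
  by move=> b; have /andP[? ?] := ternary_sum_itv R b; rewrite ger0_norm.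
- by exists (@rat_cut R); exact: rat_cut_inj.
Qed.

Section ComplexScalars.
Variable R : realType.
Local Open Scope complex_scope.

Lemma complex_ge0E (z : R[i]) : 0 <= z -> z = (complex.Re z)%:C.
Proof. by case: z => a b; rewrite lecE/= => /andP[/eqP-> _]. Qed.

Lemma complex_norm_le (z : R[i]) :
  `|z| <= (`|complex.Re z| + `|complex.Im z|)%:C.
Proof.
case: z => a b /=; have -> : a +i* b = a%:C + 'i * b%:C.
  by apply/eqP; rewrite eq_complex/= !(mul0r, mul1r, mulr0, subr0, addr0, add0r) !eqxx.
rewrite (le_trans (ler_normD _ _))// normrM !normc_def/=.
by rewrite !expr0n/= !(expr1n, add0r, addr0) sqrtr1 mul1r !sqrtr_sqr -rmorphD lecR.
Qed.

Lemma complex_Im_norm_le (z : R[i]) : `|complex.Im z|%:C <= `|z|.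
Proof.
by case: z => a b; rewrite normc_def lecR/= -sqrtr_sqr ler_wsqrtr// lerDr sqr_ge0.
Qed.

Lemma complex_scalar_props : scalar_props R[i].
Proof.
have RK := real_scalar_props R.
split.
- move=> e e0; have := e0; rewrite (complex_ge0E (ltW e0)) ltcR.
  move=> /(scalar_archi RK)[n ne]; exists n.
  by rewrite -[X in X^-1](rmorph_nat (real_complex R)) -fmorphV ltcR.
- move=> c cC.
  have part (p : R[i] -> R) : (forall z w, p (z - w) = p z - p w) ->
      (forall z, `|p z|%:C <= `|z|) ->
      exists l, forall e, 0 < e -> exists N, forall n, (N <= n)%N ->
       `|l - p (c n)| < e.
    move=> pB ple; apply: (scalar_complete RK) => e e0.
    have [|N NP] := cC e%:C; first by rewrite ltcR.
    exists N => m n Nm Nn; rewrite -pB -ltcR.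
    exact: le_lt_trans (ple _) (NP _ _ Nm Nn).
  have [|a aP] := part (@complex.Re R) _ (@normc_ge_Re R).
    by move=> [? ?] [? ?].
  have [|b bP] := part (@complex.Im R) _ complex_Im_norm_le.
    by move=> [? ?] [? ?].
  exists (a +i* b) => e e0; rewrite (complex_ge0E (ltW e0)).
  have e20 : 0 < complex.Re e / 2 by rewrite divr_gt0// -ltcR -complex_ge0E// ltW.
  have [N NP] := aP _ e20; have [M MP] := bP _ e20.
  exists (maxn N M) => n; rewrite geq_max => /andP[/NP na /MP nb].
  apply: le_lt_trans (complex_norm_le _) _; rewrite ltcR.
  by move: na nb; case: (c n) => ? ? /= na nb; rewrite [ltRHS]splitr ltrD.
- move=> A [x Ax] A0 [y yA].
  have AE z : A z -> z = (complex.Re z)%:C by move=> /A0/complex_ge0E.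
  have [|||s [sub slub]] := scalar_supremums RK (A := @complex.Re R @` A).
  + by exists (complex.Re x), x.
  + by move=> _ [z /A0 z0 <-]; rewrite -lecR -complex_ge0E.
  + by exists (complex.Re y) => _ [z /yA + <-]; rewrite lecE => /andP[].
  exists s%:C; split.
    by move=> z Az; rewrite (AE _ Az) lecR; apply: sub; exists z.
  (* Comparable complex numbers have equal imaginary parts, so an upper bound of a nonempty set of
     nonnegative numbers is itself real. *)
  move=> z zA; rewrite lecE/=; apply/andP; split.
    by have := zA _ Ax; rewrite (AE _ Ax) lecE/= => /andP[].
  by apply: slub => _ [w /zA + <-]; rewrite lecE => /andP[].
- have [t tI t2] := scalar_of_bits RK.
  exists (fun b => (t b)%:C); first by move=> b c [/tI].
  by move=> b; rewrite normc_def/= expr0n addr0 sqrtr_sqr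
    -(rmorph_nat (real_complex R)) lecR.
- have [f fI] := bits_of_scalar RK.
  (* The codes of the two coordinates are interleaved. *)
  exists (fun z n => if odd n then f (complex.Re z) n./2 else f (complex.Im z) n./2).
  move=> [a b] [c d] E; congr Complex; apply: fI; apply/funext => n.
    by have := congr1 (fun h => h n.*2.+1) E; rewrite /= odd_double/= uphalf_double.
  by have := congr1 (fun h => h n.*2) E; rewrite /= odd_double/= doubleK.
Qed.

End ComplexScalars.

Lemma scalar_field_props (R : realType) (cplx : bool) :
  scalar_props (scalar_field R cplx).
Proof. by case: cplx; [exact: complex_scalar_props|exact: real_scalar_props]. Qed.

(** * Hamel bases *)

Section HamelBases.
Variables (K : numFieldType) (V : lmodType K).
Implicit Types (U B Z W F G H : set V) (v w : V) (s : seq V) (c : V -> K).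

Lemma lin_subspaceP U : lin_subspace U <->
  U 0 /\ forall a u v, U u -> U v -> U (a *: u + v).
Proof.
split=> [[U0 UZ]|[U0 UZ]]; split.
- exact: set_mem.
- by move=> a u v Uu Uv; apply: set_mem; apply: UZ; exact: mem_set.
- exact: mem_set.
- by move=> a u v /set_mem Uu /set_mem Uv; apply: mem_set; exact: UZ.
Qed.

Lemma lin_subspace0 U : lin_subspace U -> U 0.
Proof. by move=> /lin_subspaceP[]. Qed.

Lemma lin_subspaceD U u v : lin_subspace U -> U u -> U v -> U (u + v).
Proof. by move=> /lin_subspaceP[_ UZ] Uu Uv; rewrite -[u]scale1r; exact: UZ. Qed.

Lemma lin_subspaceZ U a u : lin_subspace U -> U u -> U (a *: u).
Proof. by move=> /lin_subspaceP[U0 UZ] Uu; rewrite -[_ *: _]addr0; exact: UZ. Qed.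

Lemma lin_subspaceB U u v : lin_subspace U -> U u -> U v -> U (u - v).
Proof.
move=> US Uu Uv; rewrite -scaleN1r; apply: lin_subspaceD => //.
exact: lin_subspaceZ.
Qed.

Lemma lin_subspace_sum U (I : eqType) (s : seq I) (f : I -> V) : lin_subspace U ->
  {in s, forall i, U (f i)} -> U (\sum_(i <- s) f i).
Proof.
move=> US sU; rewrite big_seq; apply: (big_ind U) => //.
  exact: lin_subspace0.
by move=> x y; exact: lin_subspaceD.
Qed.

Lemma lin_span_min U B : lin_subspace U -> B `<=` U -> lin_span B `<=` U.
Proof.
move=> US BU _ [s [c [sB ->]]]; apply: lin_subspace_sum => // v vs.
by apply: lin_subspaceZ => //; apply/BU/sB.
Qed.

Lemma sub_lin_span B : B `<=` lin_span B.
Proof.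
move=> v Bv; exists [:: v], (fun=> 1); rewrite big_seq1 scale1r; split=> //.
by move=> w /=; rewrite inE => /eqP ->.
Qed.

(** [lin_span] admits lists with repetitions, while [lin_indep] speaks of duplicate-free lists;
    repeated vectors are merged by multiplying the coefficient by the multiplicity. *)
Lemma lin_span_uniq B v : lin_span B v -> exists s c,
  [/\ uniq s, [set` s] `<=` B & v = \sum_(w <- s) c w *: w].
Proof.
move=> [s [c [sB ->]]]; exists (undup s), (fun w => c w *+ count_mem w s).
split; first exact: undup_uniq.
  by move=> w /=; rewrite mem_undup; exact: sB.
rewrite -[LHS]big_undup_iterop_count/=; apply: eq_bigr => w _.
by rewrite Monoid.iteropE -scalerMnl iter_addr_0.
Qed.

Lemma lin_subspace_span B : lin_subspace (lin_span B).
Proof.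
apply/lin_subspaceP; split.
  by exists [::], (fun=> 0); rewrite big_nil.
move=> a u v /lin_span_uniq[s [c [us sB ->]]] /lin_span_uniq[t [d [ut tB ->]]].
(* Both combinations are moved to one common list, each coefficient being extended by 0 outside its
   own list. *)
exists (undup (s ++ t)),
  (fun w => (if w \in s then a * c w else 0) + (if w \in t then d w else 0)).
split.
  by move=> w /=; rewrite mem_undup mem_cat => /orP[/sB|/tB].
have restrict (q r : seq V) (f : V -> K) : uniq q -> uniq r -> {subset q <= r} ->
    \sum_(w <- r) (if w \in q then f w else 0) *: w = \sum_(w <- q) f w *: w.
  move=> uq ur qr; under eq_bigr do rewrite (fun_if (fun k => k *: _)) scale0r.
  rewrite -big_mkcond/= -big_filter; apply/perm_big/uniq_perm => //.
    exact: filter_uniq.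
  by move=> w; rewrite mem_filter; have [/qr|] := boolP (w \in q).
under [RHS]eq_bigr do rewrite scalerDl.
rewrite big_split/= !restrict ?undup_uniq//.
- by rewrite scaler_sumr; congr (_ + _); apply: eq_bigr => w _; rewrite scalerA.
- by move=> w wt; rewrite mem_undup mem_cat wt orbT.
- by move=> w ws; rewrite mem_undup mem_cat ws.
Qed.

Lemma lin_indep_sub B Z : Z `<=` B -> lin_indep B -> lin_indep Z.
Proof. by move=> ZB BI s c us sZ; apply: BI => //; exact: subset_trans ZB. Qed.

(** A finite list in the union of a chain already lies in a single member of the chain. *)
Lemma lin_indep_bigcup (F : set (set V)) : F !=set0 -> total_on F subset ->
  (forall B, F B -> lin_indep B) -> lin_indep (\bigcup_(B in F) B).
Proof.
move=> [B0 FB0] Ftot FI s c us sF.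
have [B FB sB] : exists2 B, F B & [set` s] `<=` B.
  elim: s sF {us} => [|v s IH] sF; first by exists B0.
  have [|B FB sB] := IH.
    by move=> w ws; apply: sF; rewrite /= inE ws orbT.
  have [C FC Cv] := sF v (mem_head _ _).
  have [BC|CB] := Ftot _ _ FB FC.
    by exists C => // w /=; rewrite inE => /orP[/eqP->//|/sB/BC].
  by exists B => // w /=; rewrite inE => /orP[/eqP->|/sB//]; exact: CB.
exact: FI FB _ _ us sB.
Qed.

Lemma lin_indep_adjoin B w : lin_indep B -> ~ lin_span B w ->
  lin_indep (w |` B).
Proof.
move=> BI nw s c us sB s0.
have cut : w \in s -> \sum_(v <- rem w s) c v *: v = - (c w *: w).
  move=> ws; move: s0; rewrite (big_rem _ ws)/= => /eqP.
  by rewrite addrC addr_eq0 => /eqP.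
have sub : [set` rem w s] `<=` B.
  by move=> v /=; rewrite mem_rem_uniq// !inE => /andP[/eqP vw /sB[]].
(* Otherwise the relation could be solved for [w], which would put [w] in the span of [B]. *)
have cw : w \in s -> c w = 0.
  move=> ws; apply/eqP/negPn/negP => cw0; apply: nw.
  have -> : w = - (c w)^-1 *: \sum_(v <- rem w s) c v *: v.
    by rewrite cut// scaleNr scalerN opprK scalerA mulVf// scale1r.
  apply: lin_subspaceZ; first exact: lin_subspace_span.
  by exists (rem w s), c.
move=> v vs; have [vw|vw] := eqVneq v w; first by rewrite vw cw// -vw.
have [ws|nws] := boolP (w \in s).
  apply: (BI (rem w s)) => //; rewrite ?rem_uniq ?mem_rem_uniq ?inE ?vw//.
  by rewrite cut// cw// scale0r oppr0.
apply: (BI s) => // u us'; have [uw|//] := sB _ us'.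
by move: nws; rewrite -uw us'.
Qed.

Lemma lin_basis_extend Z W : lin_subspace W -> Z `<=` W -> lin_indep Z ->
  exists B, [/\ Z `<=` B, lin_indep B & lin_span B = W].
Proof.
move=> WS ZW ZI.
(* The alternative [A = set0] is there for the empty chain, whose union is empty and need not
   contain [Z]. *)
have [|A [[AZ AW AI] Amax]] := @Zorn_bigcup V
    [set A | [/\ A = set0 \/ Z `<=` A, A `<=` W & lin_indep A]].
  move=> F FP Ftot; have [F0|F0] := pselect (F `<=` [set set0]).
    have -> : \bigcup_(X in F) X = set0.
      by apply/seteqP; split => // v [X /F0 ->].
    by split=> //; [left|move=> s c _ s0 _ v /s0].
  have /existsNP[B /not_implyP[FB B0]] := F0.
  split.
  - right; have [[/B0//|ZB] _ _] := FP _ FB.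
    by move=> v /ZB; exists B.
  - by move=> v [X /FP[_ XW _]] /XW.
  - apply: lin_indep_bigcup => //; first by exists B.
    by move=> X /FP[].
have {AZ} ZA : Z `<=` A.
  (* A maximal element can be empty only if [Z] is, since otherwise [Z] itself is larger. *)
  case: AZ => // A0; rewrite A0 in Amax *; have [->//|/eqP Z0] := eqVneq Z set0.
  exfalso; apply: (Amax Z); last by split=> //; right.
  by split=> //; rewrite subset0 => /Z0.
exists A; split=> //; apply/seteqP; split; first exact: lin_span_min.
move=> w Ww; apply: contrapT => nw; apply: (Amax (w |` A)).
  by split=> [x|]; [right|move=> /(_ w (or_introl erefl))/sub_lin_span].
split; last exact: lin_indep_adjoin.
  by right=> x /ZA; right.
by move=> x [->//|/AW].
Qed.

Definition lin_sum F G : set V := [set f + g | f in F & g in G].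

Definition line v : set V := range (fun a : K => a *: v).

Lemma lin_subspace_line v : lin_subspace (line v).
Proof.
apply/lin_subspaceP; split; first by exists 0; rewrite ?scale0r.
move=> a _ _ [b _ <-] [c _ <-]; exists (a * b + c) => //.
by rewrite scalerDl scalerA.
Qed.

Lemma lin_subspace_sum2 F G :
  lin_subspace F -> lin_subspace G -> lin_subspace (lin_sum F G).
Proof.
move=> FS GS; apply/lin_subspaceP; split.
  exists 0; first exact: lin_subspace0.
  by exists 0; rewrite ?addr0//; exact: lin_subspace0.
move=> a _ _ [f Ff [g Gg <-]] [f' Ff' [g' Gg' <-]].
exists (a *: f + f'); first by have /lin_subspaceP[_] := FS; exact.
exists (a *: g + g'); first by have /lin_subspaceP[_] := GS; exact.
by rewrite scalerDr addrACA.
Qed.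

Lemma lin_span_nil : lin_span [set` [::] : seq V] = [set 0].
Proof.
apply/seteqP; split=> [|_ ->]; last first.
  by apply: lin_subspace0; exact: lin_subspace_span.
apply: lin_span_min; last by move=> ? /=; rewrite in_nil.
apply/lin_subspaceP; split=> // a _ _ -> ->.
by rewrite /= scaler0 addr0.
Qed.

Lemma lin_span_cons v (s : seq V) :
  lin_span [set` v :: s] = lin_sum (lin_span [set` s]) (line v).
Proof.
apply/seteqP; split.
  apply: lin_span_min.
    by apply: lin_subspace_sum2; [exact: lin_subspace_span|exact: lin_subspace_line].
  move=> w /=; rewrite inE => /orP[/eqP->|ws].
    exists 0; first by apply: lin_subspace0; exact: lin_subspace_span.
    by exists v; rewrite ?add0r//; exists 1; rewrite ?scale1r.
  exists w; first exact: sub_lin_span.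
  by exists 0; rewrite ?addr0//; apply: lin_subspace0; exact: lin_subspace_line.
move=> _ [f fs [_ [a _ <-] <-]].
have vsS := lin_subspace_span [set` v :: s].
apply: lin_subspaceD => //; last first.
  by apply: lin_subspaceZ => //; apply: sub_lin_span; rewrite /= mem_head.
apply: lin_span_min fs => // w ws; apply: sub_lin_span.
by rewrite /= inE ws orbT.
Qed.

Lemma lin_sumA F G H : lin_sum F (lin_sum G H) = lin_sum (lin_sum F G) H.
Proof.
apply/seteqP; split=> [_ [f Ff [_ [g Gg [h Hh <-]] <-]]|].
  by rewrite addrA; exists (f + g); [exists f => //; exists g|exists h].
move=> _ [_ [f Ff [g Gg <-]] [h Hh <-]].
by rewrite -addrA; exists f => //; exists (g + h) => //; exists g => //; exists h.
Qed.

End HamelBases.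

(** * Closed sums in spaces of sequences *)

Section SequenceSpaces.
Variables (K : numFieldType) (KP : scalar_props K).
Variables (E : completeNormedModType K) (X : seq_class K).
Local Notation V := (seqs_type (X E)).
Implicit Types (v w y : V) (F G : set V).

Lemma seqsE (a : K) v w j : (a *: v + w : V) j = a *: v j + w j.
Proof. by []. Qed.

Lemma seqsD v w j : (v + w : V) j = v j + w j. Proof. by []. Qed.
Lemma seqsN v j : (- v : V) j = - v j. Proof. by []. Qed.
Lemma seqsZ a v j : (a *: v : V) j = a *: v j. Proof. by []. Qed.
Lemma seqs0 j : (0 : V) j = 0. Proof. by []. Qed.
Lemma seqs_sum (I : Type) (r : seq I) (f : I -> V) j :
  (\sum_(i <- r) f i : V) j = \sum_(i <- r) f i j.
Proof. by elim: r => [|i r IH]; rewrite ?big_nil// !big_cons seqsD IH. Qed.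

Lemma seqs_ext v w : (forall j, v j = w j) -> v = w.
Proof. by move=> vw; apply: val_inj; apply/funext. Qed.

Lemma coord_bound : exists2 C : K, 0 < C &
  forall v j, `|v j| <= C * qnorm v.
Proof.
have [C C0 CP] := class_linf_norm X E; exists C => // v j.
apply: le_trans (CP _ (seqs_dom v)).
(* [supremum] falls back on a default value if no least upper bound exists in [K];
   [scalar_supremums] excludes this case. *)
rewrite /linf_norm /supremum ifF; last first.
  by apply/negbTE/set0P; exists `|v 0%N|, 0%N.
have [|||s sP] := scalar_supremums KP (A := range (fun n => `|v n|)).
- by exists `|v 0%N|, 0%N.
- by move=> _ [n _ <-].
- have [M [Mr MP]] := class_linf (seqs_dom v).
  exists (M + 1) => _ [n _ <-]; apply: MP => //.
  by rewrite ltrDl.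
case: xgetP => [r -> [rP _]|/(_ s)//].
by apply: rP; exists j.
Qed.

Lemma scalar_inv_lt (e : K) : 0 < e ->
  exists N, forall n, (N <= n)%N -> n.+1%:R^-1 < e.
Proof.
move=> e0; have [N Ne] := scalar_archi KP e0; exists N => n Nn.
by apply: le_lt_trans Ne; rewrite lef_pV2 ?posrE// ler_nat.
Qed.

Definition approximable F v :=
  forall e : K, 0 < e -> exists2 y, F y & qnorm (v - y) < e.

Lemma closedP F : closed F <-> forall v, approximable F v -> F v.
Proof.
split=> [Fcl v vF|Fcl v vF].
  apply: Fcl => A /seqs_nbhsP[e e0 eA]; have [y Fy vy] := vF _ e0.
  by exists y; split=> //; exact: eA.
apply: Fcl => e e0; have [|y [Fy vy]] := vF [set y | qnorm (v - y) < e].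
  by apply/seqs_nbhsP; exists e.
by exists y.
Qed.

Lemma approximable_seq F v : approximable F v -> exists y : nat -> V,
  (forall n, F (y n)) /\ forall e : K, 0 < e ->
    exists N, forall n, (N <= n)%N -> qnorm (v - y n) < e.
Proof.
move=> vF.
have /choice[y yP] : forall n, exists y, F y /\ qnorm (v - y) < n.+1%:R^-1.
  by move=> n; have [|y ? ?] := vF n.+1%:R^-1; [rewrite invr_gt0|exists y].
exists y; split=> [n|e /scalar_inv_lt[N NP]]; first by have [] := yP n.
by exists N => n /NP; apply: lt_trans; have [] := yP n.
Qed.

Definition vanishing (D : set nat) : set V :=
  [set w | forall j, D j -> w j = 0].

Lemma lin_subspace_vanishing D : lin_subspace (vanishing D).
Proof.
apply/lin_subspaceP; split=> // a u v uD vD j Dj.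
by rewrite seqsE uD// vD// scaler0 addr0.
Qed.

Lemma closed_vanishing D : closed (vanishing D).
Proof.
apply/closedP => v vF j Dj; apply/eqP/negPn/negP => vj.
have [C C0 CP] := coord_bound.
have [|y yD vy] := vF (`|v j| / C).
  by rewrite divr_gt0// normr_gt0.
have := le_lt_trans (CP (v - y) j) _.
rewrite seqsD seqsN yD// subr0 => /(_ `|v j|).
by rewrite mulrC -ltr_pdivlMr// ltxx => /(_ vy).
Qed.

(** If [v] is outside the closed subspace [F], it keeps a distance [d > 0] from [F]. Then the
    coefficient of [v] is controlled by the quasi-norm of the whole vector, so coefficients along a
    convergent sequence converge too. *)
Lemma closed_sum_line F v :
  lin_subspace F -> closed F -> closed (lin_sum F (line v)).
Proof.
move=> FS Fcl; have [Fv|nFv] := pselect (F v).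
  suff -> : lin_sum F (line v) = F by [].
  apply/seteqP; split=> [_ [f Ff [_ [a _ <-] <-]]|f Ff].
    by apply: lin_subspaceD => //; exact: lin_subspaceZ.
  by exists f => //; exists 0; rewrite ?addr0//; exists 0; rewrite ?scale0r.
have [d d0 dP] : exists2 d : K, 0 < d & forall f, F f -> d <= qnorm (v - f).
  apply: contrapT => nd; apply: nFv; apply: (closedP F).1 => // e e0.
  apply: contrapT => ny; apply: nd; exists e => // f Ff.
  rewrite real_leNgt ?ger0_real ?qnorm_ge0 ?ltW//.
  by apply/negP => vf; apply: ny; exists f.
have lower (a : K) f : F f -> `|a| * d <= qnorm (a *: v + f).
  move=> Ff; have [->|a0] := eqVneq a 0.
    by rewrite normr0 mul0r qnorm_ge0.
  have -> : a *: v + f = a *: (v - - a^-1 *: f).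
    by rewrite scaleNr opprK scalerDr scalerA divff// scale1r.
  by rewrite qnormZ ler_wpM2l// dP//; exact: lin_subspaceZ.
apply/closedP => w /approximable_seq[y [yF yw]].
have /choice[a aP] : forall n, exists a, F (y n - a *: v).
  by move=> n; have [f Ff [_ [a _ <-] <-]] := yF n; exists a; rewrite addrK.
(* By [lower] the coefficients [a n] form a Cauchy sequence; their limit [l] is the coefficient of
   [v] in [w]. *)
have [|l lP] := scalar_complete KP (c := a).
  move=> e e0; have [r r0 rP] := qnorm_small (X E) (mulr_gt0 e0 d0).
  have [N NP] := yw _ r0; exists N => m n /NP ym /NP yn.
  rewrite -(ltr_pM2r d0).
  apply: le_lt_trans (lower _ _ (lin_subspaceB FS (aP m) (aP n))) _.
  have -> : (a m - a n) *: v + (y m - a m *: v - (y n - a n *: v)) =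
      (y m - w) + (w - y n).
    by rewrite scalerBl opprB addrA [a m *: v - _ + _]addrC !addrA !subrK.
  by apply: rP => //; rewrite qnormB.
exists (w - l *: v); last by exists (l *: v); [exists l|rewrite subrK].
apply: (closedP F).1 => // e e0; have [r r0 rP] := qnorm_small (X E) e0.
(* Adding 1 spares a case distinction on whether [qnorm v] vanishes. *)
have r'0 : 0 < r / (qnorm v + 1) by rewrite divr_gt0// ltr_wpDl// qnorm_ge0.
have [N NP] := yw _ r0; have [M MP] := lP _ r'0.
exists (y (maxn N M) - a (maxn N M) *: v); first exact: aP.
have -> : forall n, w - l *: v - (y n - a n *: v) = (w - y n) + - (l - a n) *: v.
  by move=> n; rewrite scaleNr scalerBl !opprB [a n *: v - y n]addrC addrACA
    [- (l *: v) + _]addrC.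
apply: rP; first by apply: NP; rewrite leq_maxl.
rewrite qnormZ normrN; apply: le_lt_trans (_ : `|l - a (maxn N M)| * (qnorm v + 1) < r).
  by rewrite ler_wpM2l// lerDl.
by rewrite -ltr_pdivlMr ?MP ?leq_maxr// ltr_wpDl// qnorm_ge0.
Qed.

Lemma closed_sum_span F (s : seq V) : lin_subspace F -> closed F ->
  closed (lin_sum F (lin_span [set` s])).
Proof.
move=> FS Fcl; elim: s => [|v s IH].
  suff -> : lin_sum F (lin_span [set` [::] : seq V]) = F by [].
  rewrite lin_span_nil; apply/seteqP; split=> [_ [f Ff [_ -> <-]]|f Ff].
    by rewrite addr0.
  by exists f => //; exists 0; rewrite ?addr0.
rewrite lin_span_cons lin_sumA; apply: closed_sum_line => //.
by apply: lin_subspace_sum2 => //; exact: lin_subspace_span.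
Qed.

End SequenceSpaces.

(** * Index sets and sequence classes *)

Lemma increasing_seq_comp (m n : nat -> nat) :
  increasing_seq m -> increasing_seq n -> increasing_seq (m \o n).
Proof. by move=> mI nI i j; rewrite /= mI; exact: nI. Qed.

(** The bijection of pairs with naturals given by [m + 1 = 2 ^ k * (2 * i + 1)]. The ranges of the
    maps [dyadic k] thus split the naturals into infinitely many infinite blocks, each enumerated in
    increasing order. *)
Definition dyadic (k i : nat) : nat := (2 ^ k * i.*2.+1).-1.

Lemma dyadicS k i : (dyadic k i).+1 = (2 ^ k * i.*2.+1)%N.
Proof. by rewrite /dyadic prednK// muln_gt0 expn_gt0. Qed.

Lemma dyadic_increasing k : increasing_seq (dyadic k).
Proof.
by move=> i j; rewrite leEnat -ltnS !dyadicS leq_pmul2l ?expn_gt0// ltnS leq_double.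
Qed.

Lemma dyadic_inj k i k' i' : dyadic k i = dyadic k' i' -> k = k' /\ i = i'.
Proof.
have dyadic_logn a b : logn 2 (dyadic a b).+1 = a.
  rewrite dyadicS lognM ?expn_gt0// pfactorK// logn_coprime ?addn0//.
  by rewrite coprime2n /= odd_double.
move=> e; have kk' : k = k' by rewrite -(dyadic_logn k i) e dyadic_logn.
split=> //; move: e; rewrite -kk' => /(congr1 (fun a => a.+1)).
rewrite !dyadicS => /eqP; rewrite eqn_pmul2l ?expn_gt0// => /eqP[].
exact: double_inj.
Qed.

Lemma dyadic_surj m : exists k i, m = dyadic k i.
Proof.
have [u u2 mE] := pfactor_coprime (isT : prime 2) (ltn0Sn m).
exists (logn 2 m.+1), u./2; apply: succn_inj.
rewrite dyadicS {1}mE mulnC; congr (_ * _)%N.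
by rewrite -[LHS]odd_double_half; move: u2; rewrite coprime2n => ->.
Qed.

Lemma infinite_set_enum (D : set nat) : infinite_set D ->
  exists n : nat -> nat, increasing_seq n /\ range n = D.
Proof.
move=> Doo.
(* The least element of [D] from [m] on; iterating this choice enumerates [D]. *)
have next m : exists j, [/\ D j, (m <= j)%N & forall i, D i -> (m <= i)%N -> (j <= i)%N].
  have /existsNP[j /not_implyP[Dj /negP mj]] : ~ (D `<=` `I_m).
    by move=> Dm; apply: Doo; exact: sub_finite_set Dm (finite_II m).
  have ex : exists j, `[< D j >] && (m <= j)%N.
    by exists j; rewrite leqNgt mj andbT; exact/asboolP.
  case: (ex_minnP ex) => i /andP[/asboolP Di mi] iP; exists i; split=> // h Dh mh.
  by apply: iP; rewrite mh andbT; exact/asboolP.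
have [f fP] := choice next.
pose n := fix n i := if i is i'.+1 then f (n i').+1 else f 0%N.
have nD i : D (n i) by case: i => [|i] /=; [have [] := fP 0%N|have [] := fP (n i).+1].
have nI : increasing_seq n.
  by apply/increasing_seqP => i; rewrite ltEnat/=; have [] := fP (n i).+1.
exists n; split=> //; apply/seteqP; split=> [_ [i _ <-]//|m Dm].
apply: contrapT => nm.
(* A missed element [m] of [D] would stay above every [n i], as each new value is the least one
   available; this contradicts [i <= n i]. *)
have lt i : (n i < m)%N.
  have ne j : n j <> m by move=> nj; apply: nm; exists j.
  elim: i => [|i IH]; rewrite ltn_neqAle; apply/andP; split; try exact/eqP/ne.
    by have [_ _] := fP 0%N; exact.
  by have [_ _] := fP (n i).+1; exact.
have ge i : (i <= n i)%N.
  elim: i => // i IH; apply: leq_ltn_trans IH _.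
  by have [] := fP (n i).+1.
by have := lt m; rewrite ltnNge ge.
Qed.

Definition seq_restrict (T : nmodType) (D : set nat) (x : nat -> T) : nat -> T :=
  fun j => if `[< D j >] then x j else 0.

Lemma seq_restrict_splitC (T : nmodType) (D : set nat) (x : nat -> T) :
  seq_restrict D x \+ seq_restrict (~` D) x = x.
Proof.
apply/funext => j; rewrite /seq_restrict /=.
case: asboolP => Dj; case: asboolP => nDj; rewrite ?addr0 ?add0r//.
Qed.

Section ClassRestrictions.
Variables (K : numFieldType) (E : completeNormedModType K) (Z : seq_class K).
Implicit Types (x y : nat -> E).

Lemma class_domD x y : seq_dom (Z E) x -> seq_dom (Z E) y -> seq_dom (Z E) (x \+ y).
Proof. exact: lin_subspaceD (seq_dom_submod (Z E)). Qed.

Lemma class_dom_subseq x (n : nat -> nat) : increasing_seq n ->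
  seq_dom (Z E) x -> seq_dom (Z E) (x \o n).
Proof. by move=> nI /(class_subseq nI)[]. Qed.

Lemma class_dom_spread x y (n : nat -> nat) : increasing_seq n ->
  seq_dom (Z E) x -> (forall i, y (n i) = x i) ->
  (forall j, ~ range n j -> y j = 0) -> seq_dom (Z E) y.
Proof. by move=> nI Zx yn y0; have [] := class_insert nI Zx yn y0. Qed.

Lemma class_dom_restrict_range x (n : nat -> nat) : increasing_seq n ->
  seq_dom (Z E) (x \o n) -> seq_dom (Z E) (seq_restrict (range n) x).
Proof.
move=> nI /(class_dom_spread nI); apply=> [i|j nj]; rewrite /seq_restrict.
  by rewrite asboolT//; exists i.
by rewrite asboolF.
Qed.

(** For infinite [D], pass to the subsequence along [D] and spread it back over [D]; for finite [D],
    the restriction is eventually null. *)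
Lemma class_dom_restrict D x :
  seq_dom (Z E) x -> seq_dom (Z E) (seq_restrict D x).
Proof.
move=> Zx; have [Dfin|/infinite_set_enum[n [nI <-]]] := pselect (finite_set D);
  last first.
  by apply: class_dom_restrict_range => //; exact: class_dom_subseq.
have /finite_seqP[s ->] := Dfin.
apply: class_c00; exists (\max_(i <- s) i).+1 => // j /= sj.
rewrite /seq_restrict asboolF// => js.
by move: sj; rewrite ltnNge (leq_bigmax_seq _ js).
Qed.
End ClassRestrictions.

(** * Copies of a sequence on disjoint blocks *)

Section Replicas.
Variables (K : numFieldType) (KP : scalar_props K).
Variables (E : completeNormedModType K) (X : seq_class K).
Local Notation V := (seqs_type (X E)).

Lemma seqs_cauchy (u : nat -> V) :
  (forall e : K, 0 < e -> exists N, forall m n, (N <= m)%N -> (N <= n)%N ->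
    qnorm (u m - u n) < e) ->
  exists l : V, forall e : K, 0 < e -> exists N, forall n, (N <= n)%N ->
    qnorm (l - u n) < e.
Proof.
move=> uC; have [|l ul] := @qbanach_complete _ _ (X E) u.
  move=> A [e e0 eA]; have [N NP] := uC _ e0.
  exists (u @` [set n | (N <= n)%N], u @` [set n | (N <= n)%N]) => /=.
    by split; exists N => // n /= Nn; exists n.
  by move=> [_ _] /= [[m Nm <-] [n Nn <-]]; apply: eA; exact: NP.
exists l => e e0; have [N _ NP] : nbhs (u @ \oo) [set y | qnorm (l - y) < e].
  by apply: ul; apply/seqs_nbhsP; exists e.
by exists N => n; exact: NP.
Qed.

Lemma seqs_spread (x : V) (q : nat -> nat) : increasing_seq q ->
  exists y : V, [/\ forall i, y (q i) = x i, vanishing (~` range q) y &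
    qnorm y <= qnorm x].
Proof.
move=> qI.
have /choice[f fP] : forall j, exists e : E,
    (forall i, q i = j -> e = x i) /\ (~ range q j -> e = 0).
  move=> j; have [[i _ <-]|nj] := pselect (range q j).
    exists (x i); split=> [i'|[]]; last by exists i.
    by move/(increasing_seq_injective qI) ->.
  by exists 0; split=> // i qi; case: nj; exists i.
have [||fX fn] := class_insert (y := f) qI (seqs_dom x).
- by move=> i; have [+ _] := fP (q i); apply.
- by move=> j nj; have [_] := fP j; apply.
exists (SeqsType (mem_set fX : f \in seqs_pred (X E))); split=> //= [i|j nj].
  by have [+ _] := fP (q i); apply.
by have [_] := fP j; apply.
Qed.

Variables (n : nat -> nat) (nI : increasing_seq n) (x : V).

Lemma replica_index_increasing k : increasing_seq (n \o dyadic k).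
Proof. by apply: increasing_seq_comp => //; exact: dyadic_increasing. Qed.

(** [n] enumerates the available indices and [n \o dyadic k] those of block [k]. The factor [a]
    depends on the block, and only membership in [V] restrains the factors. *)
Definition replicas : set V := [set w | vanishing (~` range n) w /\
  forall k, exists a : K, forall i, w (n (dyadic k i)) = a *: x i].

Lemma lin_subspace_replicas : lin_subspace replicas.
Proof.
apply/lin_subspaceP; split.
  by split=> // k; exists 0 => i; rewrite scale0r.
move=> a u v [u0 ux] [v0 vx]; split.
  by have /lin_subspaceP[_] := @lin_subspace_vanishing _ E X (~` range n); exact.
move=> k; have [b bP] := ux k; have [c cP] := vx k; exists (a * b + c) => i.
by rewrite seqsE bP cP scalerDl scalerA.
Qed.

(** With [y] a copy of [x] on block [k], being a multiple of [x] on that block means lying in the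
    sum of [line y] and the sequences that vanish there. This sum is closed by [closed_sum_line]. *)
Lemma closed_replicas : closed replicas.
Proof.
apply/closedP => w wF; split.
  have /closedP := @closed_vanishing K KP E X (~` range n).
  apply=> e /wF[y [y0 _] wy].
  by exists y.
move=> k; have [y [yx y0 _]] := seqs_spread x (replica_index_increasing k).
pose F : set V := vanishing (range (n \o dyadic k)).
have : lin_sum F (line y) w.
  have /closedP : closed (lin_sum F (line y)).
    apply: closed_sum_line => //; first exact: lin_subspace_vanishing.
    exact: closed_vanishing.
  apply=> e /wF[v [v0 /(_ k)[a av]] wv]; exists v => //.
  exists (v - a *: y); last by exists (a *: y); [exists a|rewrite subrK].
  by move=> _ [i _ <-]; rewrite seqsD seqsN seqsZ yx /= av subrr.
move=> [f fF [_ [a _ <-] <-]]; exists a => i.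
by rewrite seqsD seqsZ -yx fF ?add0r//; exists i.
Qed.

Lemma vanishing_dyadic (w : V) : vanishing (~` range n) w ->
  (forall k i, w (n (dyadic k i)) = 0) -> w = 0.
Proof.
move=> w0 wn; apply: seqs_ext => j.
have [[m _ <-]|/w0//] := pselect (range n j).
by have [k [i ->]] := dyadic_surj m; rewrite wn.
Qed.

Lemma seqs_limit_eventually (u : nat -> V) (l : V) j (e : E) :
  (forall e : K, 0 < e -> exists N, forall n, (N <= n)%N -> qnorm (l - u n) < e) ->
  (exists N, forall m, (N <= m)%N -> u m j = e) -> l j = e.
Proof.
move=> ul [N NP]; apply/eqP; rewrite -subr_eq0; apply/negPn/negP => le0.
have [C C0 CP] := coord_bound KP E X.
have [|M MP] := ul (`|l j - e| / C); first by rewrite divr_gt0// normr_gt0.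
have := le_lt_trans (CP (l - u (maxn N M)) j) _.
rewrite seqsD seqsN NP ?leq_maxl// => /(_ `|l j - e|).
by rewrite mulrC -ltr_pdivlMr// ltxx MP ?leq_maxr// => /(_ isT).
Qed.

(* For small [t] the geometric decay beats the constant of the quasi-triangle
   inequality. *)
Lemma replica_series : exists2 r : K, 0 < r & forall t : K, `|t| <= r ->
  exists2 z : V, replicas z & forall k i, z (n (dyadic k i)) = t ^+ k *: x i.
Proof.
have [C C1 Cadd] := seq_qnormD (X E).
have C0 : 0 < C by exact: lt_le_trans C1.
have Cle (v w : V) : qnorm (v + w) <= C * (qnorm v + qnorm w).
  exact: Cadd (seqs_dom v) (seqs_dom w).
exists (2 * C)^-1 => [|t tr]; first by rewrite invr_gt0 mulr_gt0.
have /choice[y yP] k := seqs_spread x (replica_index_increasing k).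
have yk k k' i : k != k' -> y k (n (dyadic k' i)) = 0.
  move=> kk'; have [_ + _] := yP k; apply => -[i' _].
  by move=> /(increasing_seq_injective nI)/dyadic_inj[/eqP]; rewrite (negbTE kk').
pose u m : V := \sum_(k < m) t ^+ k *: y k.
(* The factor [2 * C] reproduces itself in the induction: the first term and the remainder each cost
   at most [C * qnorm x] times the power [m] of the norm of [t], the remainder because [2 * C] times
   that norm is at most 1. *)
have tail p m : qnorm (\sum_(k < p) t ^+ (m + k) *: y (m + k)%N) <=
    2 * C * qnorm x * `|t| ^+ m.
  elim: p m => [|p IH] m.
    by rewrite big_ord0 qnorm0 !mulr_ge0 ?exprn_ge0 ?qnorm_ge0// ltW.
  rewrite big_ord_recl addn0; apply: le_trans (Cle _ _) _.
  have -> : 2 * C * qnorm x * `|t| ^+ m = C * (`|t| ^+ m * qnorm x + `|t| ^+ m * qnorm x).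
    by ring.
  rewrite ler_pM2l//; apply: lerD.
    by rewrite qnormZ normrX ler_wpM2l ?exprn_ge0//; have [] := yP m.
  under eq_bigr do rewrite /= /bump/= add1n addnS -addSn.
  apply: le_trans (IH m.+1) _; rewrite exprS.
  have -> : 2 * C * qnorm x * (`|t| * `|t| ^+ m) = (2 * C * `|t|) * (`|t| ^+ m * qnorm x).
    by ring.
  rewrite ler_piMl ?mulr_ge0 ?exprn_ge0 ?qnorm_ge0//.
  by rewrite mulrC -ler_pdivlMr ?mul1r// mulr_gt0.
(* As [C >= 1], the norm of [t] is at most one half; comparing with [m.+1%:R^-1] lets the
   Archimedean property make the tails small. *)
have tn m : `|t| ^+ m <= m.+1%:R^-1.
  have t2 : `|t| <= 2^-1.
    by apply: le_trans tr _; rewrite lef_pV2 ?posrE ?mulr_gt0// ler_peMr.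
  apply: (@le_trans _ _ (2^-1 ^+ m)); first by rewrite lerXn2r ?nnegrE ?invr_ge0.
  by rewrite exprVn lef_pV2 ?posrE ?exprn_gt0// -natrX ler_nat ltn_expl.
have [|l ul] := seqs_cauchy (u := u).
  move=> e e0.
  have M0 : 0 < 2 * C * qnorm x + 1 by rewrite ltr_wpDl// !mulr_ge0 ?qnorm_ge0// ltW.
  have [|N NP] := scalar_inv_lt KP (e := e / (2 * C * qnorm x + 1)).
    by rewrite divr_gt0.
  have half m p : (N <= m)%N -> qnorm (u (m + p)%N - u m) < e.
    move=> Nm; have -> : u (m + p)%N - u m = \sum_(k < p) t ^+ (m + k) *: y (m + k)%N.
      by rewrite /u big_split_ord/= addrAC subrr add0r.
    apply: le_lt_trans (tail p m) _.
    apply: (@le_lt_trans _ _ ((2 * C * qnorm x + 1) * m.+1%:R^-1)).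
      by rewrite ler_pM ?mulr_ge0 ?qnorm_ge0 ?exprn_ge0 ?lerDl// ltW.
    by rewrite mulrC -ltr_pdivlMr// NP.
  exists N => m p Nm Np; have [mp|/ltnW pm] := leqP m p.
    by rewrite qnormB -(subnKC mp) half.
  by rewrite -(subnKC pm) half.
have uE m k i : u m (n (dyadic k i)) = if (k < m)%N then t ^+ k *: x i else 0.
  rewrite /u seqs_sum; case: ltnP => km.
    rewrite (bigD1 (Ordinal km))// big1 => [|h hk].
      apply: etrans (addr0 _) _; rewrite seqsZ; by have [-> _ _] := yP k.
    by rewrite seqsZ yk ?scaler0//.
  rewrite big1// => h _; rewrite seqsZ yk ?scaler0//.
  by rewrite neq_ltn (leq_trans _ km).
(* Each coordinate of the partial sums is eventually constant, so the limit is read off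
   coordinatewise. *)
have lE k i : l (n (dyadic k i)) = t ^+ k *: x i.
  apply: (seqs_limit_eventually ul); exists k.+1 => m km.
  by rewrite uE km.
exists l => //; split; last by move=> k; exists (t ^+ k).
move=> j nj; apply: (seqs_limit_eventually ul); exists 0%N => m _.
rewrite /u seqs_sum big1// => k _; rewrite seqsZ.
have [_ y0 _] := yP k; rewrite y0 ?scaler0// => -[i _ ij].
by apply: nj; exists (dyadic k i).
Qed.

(* Evaluating on block [k] turns a linear relation into
   [\sum c * t ^+ k = 0] for every [k], which Lagrange polynomials separate. *)
Lemma lin_indep_replica_series (J : Type) (i0 : nat) (t : J -> K) (z : J -> V) :
  x i0 != 0 -> injective t ->
  (forall b k i, z b (n (dyadic k i)) = t b ^+ k *: x i) ->
  injective z /\ lin_indep (range z).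
Proof.
move=> x0 tI zE; have zI : injective z.
  move=> b c bc; apply: tI; have := zE b 1%N i0.
  rewrite bc zE !expr1 => /eqP; rewrite -subr_eq0 -scalerBl scaler_eq0 (negbTE x0) orbF.
  by rewrite subr_eq0 => /eqP.
split=> // s c us sz s0 v vs.
have /choice[b bP] : forall v, exists b, v \in s -> z b = v.
  have [b0 _ _] := sz _ vs.
  by move=> w; have [/sz[b _ <-]|] := boolP (w \in s); [exists b|exists b0].
have power k : \sum_(w <- s) c w * t (b w) ^+ k = 0.
  apply/eqP; have := @seqs0 _ E X (n (dyadic k i0)).
  rewrite -s0 seqs_sum => /eqP.
  suff -> : \sum_(w <- s) (c w *: w) (n (dyadic k i0)) =
      (\sum_(w <- s) c w * t (b w) ^+ k) *: x i0.
    by rewrite scaler_eq0 (negbTE x0) orbF.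
  rewrite scaler_suml !big_seq; apply: eq_bigr => w ws.
  by rewrite seqsZ -[in LHS](bP _ ws) zE scalerA bP.
have horner (p : {poly K}) : \sum_(w <- s) c w * p.[t (b w)] = 0.
  under eq_bigr do rewrite horner_coef mulr_sumr.
  rewrite exchange_big/= big1// => i _.
  under eq_bigr do rewrite mulrCA.
  by rewrite -mulr_sumr power mulr0.
(* This polynomial vanishes at the parameter of every [w] in the list except [v]. *)
have := horner (\prod_(w <- rem v s) ('X - (t (b w))%:P)).
rewrite (big_rem _ vs)/= [X in _ + X]big_seq [X in _ + X]big1 ?addr0 => [|w ws].
  move/eqP; rewrite mulf_eq0 => /orP[/eqP//|].
  rewrite horner_prod prodf_seq_eq0 => /hasP[w ws].
  rewrite hornerXsubC subr_eq0 => /eqP tvw; have vw := tI _ _ tvw; move: ws.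
  rewrite mem_rem_uniq// !inE => /andP[+ ws].
  by rewrite -(bP _ ws) -vw bP// eqxx.
rewrite horner_prod (big_rem _ ws)/= hornerXsubC subrr mul0r mulr0//.
Qed.

End Replicas.

(** * Coding by bits and spaceability *)

Section BitCodes.

Lemma card_bits (R : realType) : [set: nat -> bool] #= [set: R].
Proof.
rewrite card_eq_le; apply/andP; split; apply: inj_card_leTT.
  exact: ternary_sum_inj.
exact: rat_cut_inj.
Qed.

(** The code is total on [T] but has to be faithful on [S] only, so that codes of sums can be built
    from arbitrary default values outside the sum. *)
Definition bit_codable (T : Type) (S : set T) : Prop :=
  exists h : T -> nat -> bool, forall u v, S u -> S v -> h u = h v -> u = v.

Lemma bit_codable_card (T : Type) (S : set T) :
  bit_codable S -> S #<= [set: nat -> bool].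
Proof.
move=> [h hS]; rewrite -(card_le_eql (inj_card_eq (f := h) _)).
  exact: subset_card_le.
by move=> u v /set_mem Su /set_mem Sv; exact: hS.
Qed.

Variables (K : numFieldType) (KP : scalar_props K) (V : lmodType K).
Implicit Types (F G : set V) (v : V).

(** Fix one decomposition of each vector of the sum, unique or not, and interleave the codes of its
    two parts. *)
Lemma bit_codable_lin_sum F G :
  bit_codable F -> bit_codable G -> bit_codable (lin_sum F G).
Proof.
move=> [h hF] [k kG].
have /choice[p pP] : forall w, exists p : V * V,
    lin_sum F G w -> [/\ F p.1, G p.2 & p.1 + p.2 = w].
  move=> w; have [[f Ff [g Gg <-]]|nw] := pselect (lin_sum F G w).
    by exists (f, g).
  by exists (0, 0).
exists (fun w n => if odd n then h (p w).1 n./2 else k (p w).2 n./2).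
move=> u v /pP[u1 u2 uE] /pP[v1 v2 vE] e; rewrite -uE -vE; congr (_ + _).
  apply: hF => //; apply/funext => n.
  by have := congr1 (fun f => f n.*2.+1) e; rewrite /= odd_double/= uphalf_double.
apply: kG => //; apply/funext => n.
by have := congr1 (fun f => f n.*2) e; rewrite /= odd_double/= doubleK.
Qed.

Lemma bit_codable_line v : bit_codable (line v).
Proof.
have [j jI] := bits_of_scalar KP.
have /choice[a aP] : forall w, exists a, line v w -> a *: v = w.
  move=> w; have [[a _ <-]|nw] := pselect (line v w); first by exists a.
  by exists 0.
by exists (j \o a) => u w /aP uE /aP wE /jI auw; rewrite -uE auw.
Qed.

Lemma bit_codable_span (s : seq V) : bit_codable (lin_span [set` s]).
Proof.
elim: s => [|v s IH].
  by exists (fun _ _ => true) => u v; rewrite lin_span_nil => -> ->.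
by rewrite lin_span_cons; apply: bit_codable_lin_sum => //; exact: bit_codable_line.
Qed.

(** Extend the independent family [z] to a basis of [W]: it has at least as many elements as there
    are bit sequences, and no more, being a subset of the codable [W]. *)
Lemma has_dim_continuum (R : realType) (W : set V) (z : (nat -> bool) -> V) :
  lin_subspace W -> bit_codable W -> injective z -> lin_indep (range z) ->
  range z `<=` W -> has_dim W R.
Proof.
move=> WS Wc zI zind zW; have [B [zB BI BW]] := lin_basis_extend WS zW zind.
exists B; split=> //; rewrite card_eq_le; apply/andP; split.
  rewrite -(card_le_eqr (card_bits R)).
  apply: card_le_trans (bit_codable_card Wc); apply: subset_card_le.
  by rewrite -BW; exact: sub_lin_span.
rewrite -(card_le_eql (card_bits R)).
apply: card_le_trans (subset_card_le zB).
by rewrite (card_le_eqr (inj_card_eq (in2W zI))).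
Qed.

End BitCodes.

(** An element is determined by its sequence of block factors; bit [i] of factor [k] is stored at
    the index coding the pair [(k, i)]. *)
Lemma bit_codable_replicas (K : numFieldType) (KP : scalar_props K)
    (E : completeNormedModType K) (X : seq_class K) (n : nat -> nat)
    (x : seqs_type (X E)) : bit_codable (replicas n x).
Proof.
have [j jI] := bits_of_scalar KP.
have /choice[a aP] : forall w : seqs_type (X E), exists a : nat -> K,
    replicas n x w -> forall k i, w (n (dyadic k i)) = a k *: x i.
  move=> w; have [[_ /choice[a aP]]|nw] := pselect (replicas n x w).
    by exists a.
  by exists (fun=> 0).
exists (fun w m => if unpickle m is Some (k, i) then j (a w k) i else false).
move=> u v un vn e.
have auv k : a u k = a v k.
  apply: jI; apply/funext => i.
  by have := congr1 (fun f => f (pickle (k, i))) e; rewrite /= pickleK.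
apply/eqP; rewrite -subr_eq0; apply/eqP; apply: (@vanishing_dyadic _ _ _ n).
  by apply: (lin_subspaceB (lin_subspace_vanishing E X _)); [case: un|case: vn].
by move=> k i; rewrite seqsD seqsN aP// [in X in _ - X]aP// auv subrr.
Qed.

(** * Spaceability: the finite case and the infinite case *)

Section Spaceability.
Variables (R : realType) (K : numFieldType) (KP : scalar_props K).
Variables (E : completeNormedModType K) (X : seq_class K).
Variables (L : Type) (Y : L -> seq_class K).
Local Notation V := (seqs_type (X E)).
Local Notation A := (class_diff E X Y).

Lemma class_diffE (v : V) : A v <-> forall l, ~ seq_dom (Y l E) v.
Proof.
split=> [[_ nv] l Yv|nv]; first by apply: nv; exists l.
by split; [exact: seqs_dom|move=> [l _]; exact: nv].
Qed.

Lemma class_diffU0 (v : V) :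
  (forall l, seq_dom (Y l E) v -> v = 0) -> (A `|` [set 0]) v.
Proof.
move=> vY; have [->|v0] := eqVneq v 0; first by right.
by left; apply/class_diffE => l /vY /eqP; rewrite (negbTE v0).
Qed.

Lemma class_diffU0_eq0 (v : V) l :
  (A `|` [set 0]) v -> seq_dom (Y l E) v -> v = 0.
Proof. by move=> [/class_diffE/(_ l)|]. Qed.

Lemma class_domZ_inv (Z : seq_class K) (a : K) (v : nat -> E) :
  a != 0 -> seq_dom (Z E) (a *: v) -> seq_dom (Z E) v.
Proof.
move=> a0 /(lin_subspaceZ a^-1 (seq_dom_submod (Z E))).
by rewrite scalerA mulVf// scale1r.
Qed.

(** Detachability is applied to one vector after the other; each further subsequence keeps the
    earlier vectors in [Y l]. *)
Lemma detachable_seq (XY : detachable E X Y) l (s : seq V) :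
  exists2 n : nat -> nat, increasing_seq n &
    {in s, forall v : V, seq_dom (Y l E) (v \o n)}.
Proof.
elim: s => [|v s [n nI ns]]; first by exists id.
suff [m mI mv] : exists2 m : nat -> nat, increasing_seq m &
    seq_dom (Y l E) (v \o n \o m).
  exists (n \o m); first exact: increasing_seq_comp.
  move=> w; rewrite inE => /orP[/eqP->//|/ns].
  exact: class_dom_subseq.
have [Yv|nYv] := pselect (seq_dom (Y l E) (v \o n)); first by exists id.
have [|N [_ _ [m [mI _ mY]]]] := XY l (v \o n); last by exists m.
by split=> //; apply: class_dom_subseq => //; exact: seqs_dom.
Qed.

Lemma exists_closed_continuum_extension (YN : nested E Y)
    (XY : detachable E X Y) (l : L) (x : V) (Ax : A x) (s : seq V) :
  lin_span [set` s] `<=` A `|` [set 0] ->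
  exists W : set V, [/\ lin_subspace W, closed W, has_dim W R,
    lin_span [set` s] `<=` W & W `<=` A `|` [set 0]].
Proof.
move=> sA; have [n nI ns] := detachable_seq XY l s.
have [i0 xi0] : exists i, x i != 0.
  apply: contrapT => /forallNP x0; have /class_diffE/(_ l) := Ax; apply.
  have -> : x = 0 by apply: seqs_ext => i; have /negP/negPn/eqP := x0 i.
  exact: lin_subspace0 (seq_dom_submod (Y l E)).
pose U := lin_span [set` s]; pose F := replicas n x.
have US : lin_subspace U by exact: lin_subspace_span.
have FS : lin_subspace F by exact: lin_subspace_replicas.
exists (lin_sum F U); split.
- exact: lin_subspace_sum2.
- by apply: closed_sum_span => //; exact: closed_replicas.
- have [r r0 rP] := replica_series KP nI x.
  have [t tI t2] := scalar_of_bits KP.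
  (* The parameters [t b] have norm at most 2; the factor [r / 2] brings them into the range allowed
     by [replica_series]. *)
  pose t' b := r / 2 * t b.
  have r20 : r / 2 != 0 by rewrite gt_eqF// divr_gt0.
  have t'I : injective t' by move=> b c /(mulfI r20)/tI.
  have /choice[z zP] : forall b, exists z : V, F z /\
      forall k i, z (n (dyadic k i)) = t' b ^+ k *: x i.
    move=> b; have [|z Fz zb] := rP (t' b); last by exists z.
    rewrite normrM gtr0_norm ?divr_gt0// -[leRHS](@divfK _ 2)//.
    by rewrite ler_pM2l ?divr_gt0.
  have [zI zind] := lin_indep_replica_series xi0 t'I (fun b => (zP b).2).
  apply: (has_dim_continuum R _ _ zI zind).
  + exact: lin_subspace_sum2.
  + by apply: bit_codable_lin_sum; [exact: bit_codable_replicas|exact: bit_codable_span].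
  + move=> _ [b _ <-]; exists (z b); first by have [] := zP b.
    by exists 0; rewrite ?addr0//; exact: lin_subspace0.
- by move=> u Uu; exists 0; [exact: lin_subspace0|exists u; rewrite ?add0r].
move=> _ [f [f0 fx] [u Uu <-]]; apply: class_diffU0 => l' Yw.
have un : seq_dom (Y l E) (u \o n).
  apply: (lin_span_min (U := [set v : V | seq_dom (Y l E) (v \o n)]) _ ns Uu).
  have YS := seq_dom_submod (Y l E).
  apply/lin_subspaceP; split; first exact: lin_subspace0 YS.
  by move=> a v v' Yv; exact: lin_subspaceD YS (lin_subspaceZ a YS Yv).
(* On [range n] the vector [u] belongs to [Y l]; off [range n] it agrees with [f + u], hence belongs
   to [Y l']. The larger of the two classes contains all of [u]. *)
have u0 : u = 0.
  have uD : seq_dom (Y l E) (seq_restrict (range n) u).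
    exact: class_dom_restrict_range.
  have uC : seq_dom (Y l' E) (seq_restrict (~` range n) u).
    have := class_dom_restrict (~` range n) Yw; congr (seq_dom _ _).
    apply/funext => j; rewrite /seq_restrict; case: asboolP => // nj.
    by rewrite seqsD f0// add0r.
  have [YY|YY] := YN l l'.
    apply: (class_diffU0_eq0 (l := l') (sA _ Uu)).
    by rewrite -(seq_restrict_splitC (range n) u); apply: class_domD => //; exact: YY.
  apply: (class_diffU0_eq0 (l := l) (sA _ Uu)).
  by rewrite -(seq_restrict_splitC (range n) u); apply: class_domD => //; exact: YY.
(* Now [f] alone is in [Y l']; a nonzero factor on some block would put [x] in [Y l'] as a
   subsequence of [f], up to that factor. *)
move: Yw; rewrite u0 addr0 => Yf; apply: (vanishing_dyadic f0) => k i.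
have [a aP] := fx k; rewrite aP; have [->|a0] := eqVneq a 0; first by rewrite scale0r.
have /class_diffE/(_ l')[] := Ax; apply: (class_domZ_inv a0).
have -> : a *: (x : nat -> E) = f \o (n \o dyadic k).
  by apply/funext => j; rewrite -[LHS]aP.
by apply: class_dom_subseq => //; exact: replica_index_increasing.
Qed.

Lemma spaceable_finite (YN : nested E Y) (XY : detachable E X Y) (l : L)
    (alpha : Type) : A !=set0 -> [set: alpha] #<= [set: R] ->
  finite_set [set: alpha] -> spaceable alpha R A.
Proof.
move=> [x Ax] alphaR alphafin.
have ext := exists_closed_continuum_extension YN XY l Ax.
split.
  (* Extending the zero space gives a subspace of dimension continuum, and part of its basis spans a
     subspace of dimension [alpha]. *)
  have [|W [WS _ [B [BI BW BR]] _ WA]] := ext [::].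
    by rewrite lin_span_nil => _ ->; right.
  have : [set: alpha] #<= B by rewrite (card_le_eqr BR).
  move=> /card_subP[B' B'alpha B'B].
  exists (lin_span B'); split; first exact: lin_subspace_span.
    by exists B'; split=> //; exact: lin_indep_sub BI.
  apply: subset_trans WA; apply: lin_span_min => //; apply: subset_trans B'B _.
  by rewrite -BW; exact: sub_lin_span.
move=> U US [B [BI <- Balpha]] UA.
have /finite_seqP[s Bs] : finite_set B.
  by apply: card_le_finite alphafin; rewrite (card_le_eql Balpha).
by move: UA; rewrite Bs => /ext.
Qed.

Lemma qnorm_scale_lt (v : V) (e : K) : 0 < e ->
  exists2 a : K, a != 0 & qnorm (a *: v) < e.
Proof.
move=> e0; have v0 : 0 < qnorm v + 1 by rewrite ltr_wpDl// qnorm_ge0.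
exists (e / (qnorm v + 1)); first by rewrite gt_eqF// divr_gt0.
rewrite qnormZ gtr0_norm ?divr_gt0// mulrAC ltr_pdivrMr// ltr_pM2l//.
by rewrite ltrDl.
Qed.

Lemma not_spaceable_infinite (l : L) (alpha : Type) :
  A !=set0 -> [set: nat] #<= [set: alpha] -> ~ spaceable alpha R A.
Proof.
move=> [x Ax] natalpha [[U [US [B [BI BU Balpha]] UA]] ext].
have [e e0] : exists e : E, e != 0.
  apply: contrapT => /forallNP E0; have /class_diffE/(_ l) := Ax; apply.
  have -> : x = 0 by apply: seqs_ext => i; have /negP/negPn/eqP -> := E0 (x i).
  exact: lin_subspace0 (seq_dom_submod (Y l E)).
pose f0 (j : nat) : E := if j == 0%N then e else 0.
have f0c : c00 E f0 by exists 1%N => // -[|j].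
pose f : V := SeqsType (mem_set (@class_c00 _ X E _ f0c) : f0 \in seqs_pred (X E)).
have fY l' : seq_dom (Y l' E) f by exact: (@class_c00 _ (Y l') E _ f0c).
have : [set: nat] #<= B by rewrite (card_le_eqr Balpha).
move=> /card_le_injP[g' [g'B g'I]].
pose g m := g' (SigSub (mem_set (I : [set: nat] m))).
have gB m : B (g m) by exact: g'B.
have gI : injective g by move=> m m' /g'I[].
(* The pair holds the coefficients of [v] and of [f] in the perturbed vector: [(a, 1)] with [a *: v]
   small for [v = g m], and [(1, 0)], meaning no change, for the other basis vectors. *)
have /choice[p pP] : forall v : V, exists p : K * K, p.1 != 0 /\
    forall m, g m = v -> p.2 = 1 /\ qnorm (p.1 *: v) < m.+1%:R^-1.
  move=> v; have [[m _ <-]|nv] := pselect (range g v).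
    have [|a a0 av] := qnorm_scale_lt (g m) (e := m.+1%:R^-1).
      by rewrite invr_gt0.
    by exists (a, 1); split=> // m' /gI ->.
  by exists (1, 0); split=> [|m gm]; [exact: oner_neq0|case: nv; exists m].
pose phi v := (p v).1 *: v + (p v).2 *: f.
(* A combination of perturbed vectors lying in [Y l'] is trivial: subtracting its multiple of [f],
   which is in [Y l'], leaves a vector of [U] in [Y l'], hence 0, and [B] is independent. This
   yields the injectivity of [phi], the independence of its image and the inclusion of the new span
   in [A] with 0. *)
have key l' (s : seq V) (c : V -> K) : uniq s -> [set` s] `<=` B ->
    seq_dom (Y l' E) (\sum_(v <- s) c v *: phi v : V) -> {in s, forall v, c v = 0}.
  move=> us sB.
  have -> : \sum_(v <- s) c v *: phi v = \sum_(v <- s) (c v * (p v).1) *: v +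
      (\sum_(v <- s) c v * (p v).2) *: f.
    rewrite scaler_suml -big_split/=; apply: eq_bigr => v _.
    by rewrite scalerDr !scalerA.
  set u := \sum_(v <- s) _ *: v; set b := \sum_(v <- s) _ => Yub.
  have Yu : seq_dom (Y l' E) u.
    have YS := seq_dom_submod (Y l' E).
    by have := lin_subspaceB YS Yub (lin_subspaceZ b YS (fY l')); rewrite addrK.
  have Uu : U u.
    apply: lin_subspace_sum => // v vs; apply: lin_subspaceZ => //.
    by rewrite -BU; apply: sub_lin_span; exact: sB.
  have u0 := class_diffU0_eq0 (UA _ Uu) Yu.
  move=> v vs; have /eqP := BI s _ us sB u0 v vs.
  by rewrite mulf_eq0 => /orP[/eqP//|]; have [/negbTE -> _] := pP v.
have phiI : {in B &, injective phi}.
  move=> v w /set_mem Bv /set_mem Bw vw; apply/eqP/negPn/negP => nvw.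
  pose c u : K := if u == v then 1 else -1.
  suff /eqP : c v = 0 by rewrite /c eqxx oner_eq0.
  apply: (key l [:: v; w] c).
  - by rewrite /= inE nvw.
  - by move=> u /=; rewrite !inE => /orP[] /eqP->.
  - rewrite big_cons big_seq1 /c eqxx eq_sym (negbTE nvw) vw scale1r scaleN1r subrr.
    exact: lin_subspace0 (seq_dom_submod (Y l E)).
  - exact: mem_head.
(* The same for lists of vectors of the image, pulled back along [phi]. *)
have key' l' (s : seq V) (c : V -> K) : uniq s -> [set` s] `<=` phi @` B ->
    seq_dom (Y l' E) (\sum_(v <- s) c v *: v : V) -> {in s, forall v, c v = 0}.
  move=> us sB Ys.
  have /choice[psi psiP] : forall v, exists w, v \in s -> B w /\ phi w = v.
    by move=> v; have [/sB[w Bw wv]|] := boolP (v \in s); [exists w|exists 0].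
  have psiK v : v \in s -> phi (psi v) = v by move=> /psiP[].
  move=> v vs; rewrite -(psiK _ vs).
  apply: (key l' (map psi s) (c \o phi)).
  - rewrite map_inj_in_uniq// => a b sa sb ab.
    by rewrite -(psiK _ sa) ab psiK.
  - by move=> _ /= /mapP[w /psiP[Bw _] ->].
  - congr (seq_dom _ _): Ys; congr (seqs_val _).
    rewrite big_map !big_seq; apply: eq_bigr => w ws.
    by rewrite /= psiK.
  - by rewrite map_f.
have [||W [WS Wcl _ UW WA]] := ext (lin_span (phi @` B)) (lin_subspace_span _).
- exists (phi @` B); split=> //.
    move=> s c us sB s0; apply: (key' l) => //; rewrite s0.
    exact: lin_subspace0 (seq_dom_submod (Y l E)).
  by rewrite (card_eql (inj_card_eq phiI)).
- move=> _ /lin_span_uniq[s [c [us sB ->]]]; apply: class_diffU0 => l' /key' c0.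
  by rewrite big_seq big1// => v vs; rewrite c0// scale0r.
(* The vectors [phi (g m)] of [W] differ from [f] by less than [m.+1%:R^-1], so the closed [W]
   contains [f], a nonzero element of [Y l]. *)
have : W f.
  apply: (closedP W).1 => // r r0; have [m mr] := scalar_archi KP r0.
  exists (phi (g m)); first by apply/UW/sub_lin_span; exists (g m).
  have [_ /(_ m erefl)[p2 p1]] := pP (g m); rewrite qnormB /phi p2 scale1r addrK.
  exact: lt_trans mr.
move=> /WA/class_diffU0_eq0/(_ (fY l)) f_0.
have : f 0%N = 0 by rewrite f_0.
by move/eqP; rewrite (negbTE e0).
Qed.

End Spaceability.

Theorem corollary5p1 (R : realType) (CH : continuum_hypothesis R)
    (cplx : bool) (E : completeNormedModType (scalar_field R cplx))
    (X : seq_class (scalar_field R cplx))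
    (Lambda : Type) (Lambda_nonempty : inhabited Lambda)
    (Y : Lambda -> seq_class (scalar_field R cplx))
    (Y_nested : nested E Y) (XY_detachable : detachable E X Y)
    (XY_nonempty : class_diff E X Y !=set0)
    (alpha : Type) (alpha_le_c : [set: alpha] #<= [set: R]) :
  spaceable alpha R (class_diff E X Y) <-> card_lt alpha nat.
Proof.
have [l] := Lambda_nonempty; have KP := scalar_field_props R cplx.
split=> [sp|[_ /finite_setPn afin]]; last exact: spaceable_finite l _ _ _ _.
have afin : finite_set [set: alpha].
  by apply/finite_setPn => na; exact: (not_spaceable_infinite KP l XY_nonempty na sp).
by split; [exact: finite_set_countable|apply/finite_setPn].
Qed.
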